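(* Let $(X,d)$ be a metric space and let $\mathcal{S}$ be a bornology on $X$. Then the following statements are equivalent: (i) $\mathcal{S}$ is a totally bounded family on $X$ and $\mathcal{S}\subseteq\mathcal{T}\mathcal{B}_d(X)$; (ii) $(CL(X),\tau_{\mathcal{S},d})$ is second countable.
   Context: For a metric space $(X,d)$, $\mathcal{P}_0(X)$ is the set of all nonempty subsets of $X$, $CL(X)$ the set of all nonempty closed subsets, and $\mathcal{T}\mathcal{B}_d(X)$ the family of all nonempty $d$-totally bounded subsets. A bornology on $X$ is a family $\mathcal{S}\subseteq\mathcal{P}_0(X)$ that is closed under finite unions and under taking (nonempty) subsets and covers $X$. For $x\in X$ and $A\in\mathcal{P}_0(X)$, $d(x,A)=\inf\{d(x,a):a\in A\}$, and $B_d(A,\epsilon)=\{x\in X:d(x,A)<\epsilon\}$. The topology $\tau_{\mathcal{S},d}$ on $CL(X)$ is induced by the uniformity having as a base the sets $[S,\epsilon]=\{(A,C)\in CL(X)\times CL(X): \sup_{x\in S}|d(x,A)-d(x,C)|<\epsilon\}$, $S\in\mathcal{S}$, $\epsilon>0$. A nonempty family $\mathcal{S}\subseteq\mathcal{P}_0(X)$ is a totally bounded family on $X$ if there is a countable subcollection $\{S_n:n\in\mathbb{N}\}$ of $\mathcal{S}$ such that for each $S\in\mathcal{S}$ and $\epsilon>0$ we have $S\subseteq\bigcup_{n\in F}B_d(S_n,\epsilon)$ for some finite subset $F$ of $\mathbb{N}$. *)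

(* Defs.v *)
From HB Require Import structures.
From mathcomp Require Import all_boot all_order all_algebra.
From mathcomp Require Import all_classical all_reals.
From mathcomp Require Import ereal topology.

Set Implicit Arguments.
Unset Strict Implicit.
Unset Printing Implicit Defensive.

Import Order.TTheory GRing.Theory Num.Theory.

Local Open Scope classical_set_scope.
Local Open Scope ring_scope.

Section MetricNotions.
Context {R : realType} {X : metricType R}.
Implicit Types (A C : set X) (S : set (set X)).

Definition dist_set (x : X) A : R := inf [set mdist x a | a in A].

Definition enlargement A (e : R) : set X := [set x | dist_set x A < e].

Definition totally_bounded A : Prop :=
  forall e : R, 0 < e ->
    exists2 F : set X, finite_set F & A `<=` \bigcup_(x in F) ball x e.

Definition TB : set (set X) := [set A | A !=set0 /\ totally_bounded A].

(* Only binary unions are needed: the empty union is the empty set, which is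
   excluded because the members of S are nonempty. *)
Definition bornology S : Prop :=
  [/\ forall A, S A -> A !=set0,
      forall A C, S A -> S C -> S (A `|` C),
      forall A C, S A -> C !=set0 -> C `<=` A -> S C
    & \bigcup_(A in S) A = [set: X]].

Definition totally_bounded_family S : Prop :=
  [/\ S !=set0,
      forall A, S A -> A !=set0
    & exists2 s : nat -> set X, forall n, S (s n) &
        forall A (e : R), S A -> 0 < e ->
          exists2 F : set nat, finite_set F &
            A `<=` \bigcup_(n in F) enlargement (s n) e].

End MetricNotions.

Definition CL {R : realType} (X : metricType R) : Type :=
  {A : set X | A !=set0 /\ closed A}.

(* The supremum is taken in the extended reals, since the members of a
   bornology need not be bounded. *)
Definition basic_entourage {R : realType} {X : metricType R} (S : set X)
    (e : R) : set (CL X * CL X) :=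
  [set AC | (ereal_sup [set (`|dist_set x (sval AC.1)
                               - dist_set x (sval AC.2)|)%:E | x in S]
             < e%:E)%E].

Definition bornology_entourage {R : realType} {X : metricType R}
    (S : set (set X)) : set_system (CL X * CL X) :=
  filter_from [set Ae : set X * R | S Ae.1 /\ 0 < Ae.2]
              (fun Ae => basic_entourage Ae.1 Ae.2).

Section Uniformity.
Context {R : realType} {X : metricType R} (S : set (set X)).
Implicit Types (A : set X) (e : R).

Lemma basic_entourage_le A (e : R) (B C : CL X) :
  (forall x, A x -> `|dist_set x (sval B) - dist_set x (sval C)| <= e / 2) ->
  0 < e -> basic_entourage A e (B, C).
Proof.
move=> h e0; rewrite /basic_entourage/=.
apply: (@le_lt_trans _ _ (e / 2)%:E); last first.
  by rewrite lte_fin ltr_pdivrMr// ltr_pMr// ltr1n.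
by apply: ge_ereal_sup => _ [x Ax <-]; rewrite lee_fin h.
Qed.

Lemma basic_entourageW A A' (e e' : R) : A `<=` A' -> e' <= e ->
  basic_entourage A' e' `<=` basic_entourage A e.
Proof.
move=> AA' ee' [B C]; rewrite /basic_entourage/= => h.
rewrite (lt_le_trans _ (_ : e'%:E <= e%:E)%E) ?lee_fin//.
apply: le_lt_trans h; apply: ereal_sup_le => _ [x Ax <-].
by exists x => //; exact: AA'.
Qed.

Lemma basic_entourage_lt A (e : R) (B C : CL X) (x : X) :
  basic_entourage A e (B, C) -> A x ->
  `|dist_set x (sval B) - dist_set x (sval C)| < e.
Proof.
move=> h Ax; rewrite -lte_fin; apply: le_lt_trans h.
by apply: ereal_sup_ubound; exists x.
Qed.

Hypotheses (X0 : [set: X] !=set0) (bS : bornology S).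

Lemma bornology_neq0 : S !=set0.
Proof.
case: bS X0 => _ _ _ cov [x xT].
by move: xT; rewrite -cov => -[A SA _]; exists A.
Qed.

Lemma bornology_entourage_filter : Filter (bornology_entourage S).
Proof.
apply: filter_from_filter.
  by have [A SA] := bornology_neq0; exists (A, 1); split => //=.
move=> [A e] [A' e'] /= [SA e0] [SA' e'0].
exists (A `|` A', Order.min e e') => /=.
  by split; [case: bS => _ h _ _; exact: h|rewrite lt_min e0].
move=> BC h; split; apply: basic_entourageW h.
- by left.
- by rewrite ge_min lexx.
- by right.
- by rewrite ge_min lexx orbT.
Qed.

Lemma bornology_entourage_diagonal E :
  bornology_entourage S E -> diagonal `<=` E.
Proof.
move=> [[A e] /= [SA e0] AE] [B C] /diagonalP -> ; apply: AE.
by apply: basic_entourage_le => // x _; rewrite subrr normr0 divr_ge0// ltW.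
Qed.

Lemma bornology_entourage_inv E :
  bornology_entourage S E -> bornology_entourage S (E^-1)%relation.
Proof.
move=> [[A e] /= Ae AE]; exists (A, e) => //= -[B C] h; apply: AE.
move: h; rewrite /basic_entourage/=; congr (ereal_sup _ < _)%E.
by apply: eq_imagel => x _; rewrite distrC.
Qed.

Lemma bornology_entourage_split E : bornology_entourage S E ->
  exists2 E', bornology_entourage S E' & (E' \; E' `<=` E)%relation.
Proof.
move=> [[A e] /= [SA e0] AE]; exists (basic_entourage A (e / 2 / 2)).
  by exists (A, e / 2 / 2) => //=; rewrite !divr_gt0.
move=> [B D] [C BC CD]; apply: AE; apply: basic_entourage_le => // x Ax.
apply: le_trans (ler_distD (dist_set x (sval C)) _ _) _.
rewrite [leRHS]splitr lerD// ltW//.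
- exact: basic_entourage_lt BC Ax.
- exact: basic_entourage_lt CD Ax.
Qed.

End Uniformity.

(* CL X carrying the topology tau_{S,d}; the proofs are parameters because the
   sets [S, e] form a base of a uniformity only for a nonempty family that is
   directed under inclusion. *)
Definition hyperspace {R : realType} {X : metricType R} {S : set (set X)}
  (X0 : [set: X] !=set0) (bS : bornology S) : Type := CL X.

Section HyperspaceUniform.
Context {R : realType} {X : metricType R} {S : set (set X)}.
Variables (X0 : [set: X] !=set0) (bS : bornology S).

HB.instance Definition _ := gen_eqMixin (hyperspace X0 bS).
HB.instance Definition _ := gen_choiceMixin (hyperspace X0 bS).
HB.instance Definition _ := @isUniform.Build (hyperspace X0 bS)
  (bornology_entourage S)
  (bornology_entourage_filter X0 bS)
  (@bornology_entourage_diagonal R X S)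
  (@bornology_entourage_inv R X S)
  (@bornology_entourage_split R X S).

End HyperspaceUniform.

(* Main.v *)
Require Import Defs.
From mathcomp Require Import all_boot all_order all_algebra.
From mathcomp Require Import all_classical all_reals.
From mathcomp Require Import ereal topology.
From mathcomp Require Import lra.

Local Open Scope classical_set_scope.
Local Open Scope ring_scope.

Import Order.TTheory GRing.Theory Num.Theory.

(** The theorem splits through separability of [X]: given [S `<=` TB], the
    family [S] is totally bounded exactly when [X] is separable, because a
    bornology contains all singletons and totally bounded sets are covered by
    finitely many small balls with centres in any prescribed dense sequence
    ([totally_bounded_family_separable], [separable_totally_bounded_family]).
    So (i) may be replaced by: [S `<=` TB] and [X] is separable.

    If this holds and [d] is a dense sequence, every function
    [x |-> dist_set x A] is 1-Lipschitz, hence its values on a member of [S]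
    are known up to [e] from its values at finitely many [d n]. The topology is
    therefore that of pointwise convergence of distance functions on the [d n],
    and rational cylinders form a countable base
    ([separable_second_countable]).

    Conversely, let the hyperspace be second countable. Picking one singleton
    in each basic open set that contains some gives a dense sequence of [X]
    ([second_countable_separable]). If a member of [S] were not totally
    bounded, it would contain a sequence with pairwise distances at least [e];
    all nonempty subsets of its range are closed, and any two distinct ones have
    distance functions differing by at least [e] at some point of that member.
    This uniformly discrete family has the cardinality of the power set of
    [nat], while small basic open neighbourhoods of its members are pairwise
    distinct, so that it would inject into a countable base, against Cantor's
    theorem ([second_countable_totally_bounded]). *)

(** * Distance to a set *)

Section Distance.
Context {R : realType} {X : metricType R}.
Implicit Types (A : set X) (x y : X).

Lemma dist_set_le x A a : A a -> dist_set x A <= mdist x a.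
Proof.
move=> Aa; apply: ge_inf; last by exists a.
by exists 0 => _ [b _ <-]; exact: mdist_ge0.
Qed.

Lemma le_dist_set x A e : A !=set0 ->
  (forall a, A a -> e <= mdist x a) -> e <= dist_set x A.
Proof.
move=> [a Aa] h; apply: lb_le_inf; first by exists (mdist x a), a.
by move=> _ [b Ab <-]; exact: h.
Qed.

Lemma dist_set_lt x A e : A !=set0 -> dist_set x A < e ->
  exists2 a, A a & mdist x a < e.
Proof.
move=> [a Aa] /inf_lt[]; first by exists (mdist x a), a.
by move=> _ [b Ab <-] be; exists b.
Qed.

Lemma dist_set_mem x A : A x -> dist_set x A = 0.
Proof.
move=> Ax; apply/eqP; rewrite eq_le -{1}(mdistxx x) dist_set_le//=.
by apply: le_dist_set => [|a _]; [exists x|exact: mdist_ge0].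
Qed.

Lemma dist_set1 x y : dist_set x [set y] = mdist x y.
Proof. by rewrite /dist_set image_set1 inf1. Qed.

(** Distance functions are equicontinuous: this is what lets finitely many
    values control them on a totally bounded set. *)
Lemma dist_set_lip x y A : A !=set0 ->
  `|dist_set x A - dist_set y A| <= mdist x y.
Proof.
move=> A0.
have h u v : dist_set u A - dist_set v A <= mdist u v.
  rewrite lerBlDr addrC -lerBlDr; apply: le_dist_set => // a Aa.
  rewrite lerBlDr addrC.
  exact: le_trans (dist_set_le _ _ _ Aa) (metric_triangle _ _ _).
by rewrite ler_norml h andbT lerNl opprB metric_sym h.
Qed.

(** A point of the closure outside [A] would have two distinct points of [A]
    within [e / 2] of it. *)
Lemma closed_separated A e : 0 < e ->
  (forall a b, A a -> A b -> a <> b -> e <= mdist a b) -> closed A.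
Proof.
move=> e0 sepA x clx.
have e20 : 0 < e / 2 by rewrite divr_gt0.
have [a [Aa]] := clx _ (nbhsx_ballx x (e / 2) e20).
rewrite ballEmdist /= => xa.
have [->//|nxa] := eqVneq x a.
(* The radius [mdist x a] is less than [e / 2] and excludes [a] itself. *)
have xa0 : 0 < mdist x a by rewrite mdist_gt0.
have [b [Ab]] := clx _ (nbhsx_ballx x _ xa0).
rewrite ballEmdist /= => xb.
have nab : a <> b by move=> ab; rewrite ab ltxx in xb.
have := sepA a b Aa Ab nab.
have := metric_triangle a x b; rewrite (metric_sym a x).
by move=> h1 h2; exfalso; lra.
Qed.

End Distance.

(** * Separability and total boundedness *)

Section Separable.
Context {R : realType} {X : metricType R}.

Definition dense_seq (d : nat -> X) : Prop :=
  forall x (e : R), 0 < e -> exists n, mdist x (d n) < e.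

Definition separable : Prop := exists d, dense_seq d.

Lemma separable_countable (D : set X) : [set: X] !=set0 -> countable D ->
  (forall x (e : R), 0 < e -> exists2 y, D y & mdist x y < e) -> separable.
Proof.
move=> [x0 _] /pfcard_geP[->|[d]] densD.
  by have [] := densD x0 1 ltr01.
exists d => x e /(densD x)[y Dy xy].
by have [n _ dn] := @surj _ _ _ _ d y Dy; exists n; rewrite dn.
Qed.

(** Moving each of the finitely many given centres by less than [e / 2] puts
    the centres in the dense sequence. *)
Lemma totally_bounded_net (d : nat -> X) (A : set X) (e : R) :
    dense_seq d -> totally_bounded A -> 0 < e ->
  exists E : seq nat, forall x, A x -> exists2 n, n \in E & mdist x (d n) < e.
Proof.
move=> densd tbA e0; have e20 : 0 < e / 2 by rewrite divr_gt0.
have [_ /finite_seqP[s ->] As] := tbA _ e20.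
have [g gP] := choice (fun x => densd x _ e20).
exists (map g s) => x /As[y /= ys]; rewrite ballEmdist /= => yx.
exists (g y); first exact: map_f.
have := metric_triangle x y (d (g y)); rewrite (metric_sym x y).
have := gP y; lra.
Qed.

Lemma bornology1 {S : set (set X)} (x : X) : bornology S -> S [set x].
Proof.
move=> [_ _ subS covS]; have : [set: X] x by [].
rewrite -covS => -[A SA Ax]; apply: (subS A) => //; first by exists x.
by move=> _ ->.
Qed.

(** The centres of finite [1 / (k + 1)]-nets of the countably many sets [s n]
    form a dense set: applied to the singleton of [x], the covering property
    gives a point of some [s n] close to [x]. *)
Lemma totally_bounded_family_separable (S : set (set X)) :
    [set: X] !=set0 -> bornology S -> S `<=` TB ->
  totally_bounded_family S -> separable.
Proof.
move=> X0 bS STB [_ Sn0 [s Ss sP]].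
have net (nk : nat * nat) : exists F : set X, finite_set F /\
    s nk.1 `<=` \bigcup_(x in F) ball x (nk.2.+1%:R^-1 : R).
  have [_ /(_ nk.2.+1%:R^-1)[]] := STB _ (Ss nk.1); first by rewrite invr_gt0.
  by move=> F; exists F.
have [F FP] := choice net.
apply: (separable_countable (\bigcup_nk F nk)) => //.
  apply: bigcup_countable => // nk _.
  by apply: finite_set_countable; case: (FP nk).
move=> x e e0; have e20 : 0 < e / 2 by rewrite divr_gt0.
have [G _ /(_ x erefl)[n _ /=]] := sP _ _ (bornology1 x bS) e20.
move=> /(dist_set_lt _ _ _ (Sn0 _ (Ss n)))[a sa xa].
have [k] := ltr_add_invr e20; rewrite add0r => ke.
have [_ /(_ a sa)[y Fy]] := FP (n, k).
rewrite ballEmdist => ya0; have ya := lt_trans ya0 ke.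
exists y; first by exists (n, k).
have := metric_triangle x a y; rewrite (metric_sym a y); lra.
Qed.

(** The singletons of a dense sequence witness total boundedness of the
    family. *)
Lemma separable_totally_bounded_family (S : set (set X)) :
    [set: X] !=set0 -> bornology S -> S `<=` TB ->
  separable -> totally_bounded_family S.
Proof.
move=> [x0 _] bS STB [d densd]; split.
- by exists [set x0]; exact: bornology1.
- by case: bS.
- exists (fun n => [set d n]) => [n|A e SA e0]; first exact: bornology1.
  have [_ tbA] := STB _ SA.
  have [E EP] := totally_bounded_net _ _ _ densd tbA e0.
  exists [set` E]; first exact: finite_seq.
  move=> x /EP[n nE xn]; exists n => //.
  by rewrite /enlargement /= dist_set1.
Qed.

(** Finitely many [e]-balls never exhaust [A], so points can be chosen greedily,
    each one at distance at least [e] from all its predecessors. *)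
Lemma not_totally_bounded_separated (A : set X) : ~ totally_bounded A ->
  exists2 e : R, 0 < e & exists2 u : nat -> X, forall n, A (u n) &
    forall m n, m <> n -> e <= mdist (u m) (u n).
Proof.
move=> /existsNP[e /not_implyP[e0 /forall2NP ntb]]; exists e => //.
have next (s : seq X) : exists x, A x /\ forall y, y \in s -> e <= mdist y x.
  have [nfin|/existsNP[x /not_implyP[Ax xs]]] := ntb [set` s].
    by exfalso; apply: nfin; exact: finite_seq.
  exists x; split => // y ys; rewrite leNgt; apply/negP => yx.
  by apply: xs; exists y => //; rewrite ballEmdist.
have [f fP] := choice next.
(* [l n] lists the first [n] points chosen, and [f (l n)] is the next one. *)
pose l n := iter n (fun s => f s :: s) [::].
have ltl m n : (m < n)%N -> f (l m) \in l n.
  elim: n => // n IH; rewrite ltnS leq_eqVlt /= in_cons => /orP[/eqP->|/IH ->].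
    by rewrite eqxx.
  by rewrite orbT.
exists (f \o l) => [n|m n mn] /=; first by have [] := fP (l n).
have [lt|lt|//] := ltngtP m n.
- by have [_] := fP (l n); apply; exact: ltl.
- by rewrite metric_sym; have [_] := fP (l m); apply; exact: ltl.
Qed.

End Separable.

Lemma Cantor_set_nat (f : set nat -> nat) : ~ injective f.
Proof.
move=> injf; pose D := [set n | exists2 I, f I = n & ~ I n].
have DP : D (f D) <-> ~ D (f D).
  by split => [[I /injf-> //]|nD]; exists D.
have nD : ~ D (f D) by move=> h; exact: (iffLR DP h h).
exact: nD (iffRL DP nD).
Qed.

(** * The topology of uniform convergence of distance functions *)

Section Hyperspace.
Context {R : realType} {X : metricType R} {S : set (set X)}.
Variables (X0 : [set: X] !=set0) (bS : bornology S).
Local Notation H := (hyperspace X0 bS).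

Lemma hyperspace_nbhsP (A : H) (U : set H) : nbhs A U <->
  exists2 Te : set X * R, S Te.1 /\ 0 < Te.2 &
    forall C : H, basic_entourage Te.1 Te.2 (A, C) -> U C.
Proof.
rewrite nbhsP; split => [[E [Te SeTe TeE] EU]|[Te SeTe TeU]].
  by exists Te => // C TeC; apply: EU; apply/xsectionP; exact: TeE.
exists (basic_entourage Te.1 Te.2); first by exists Te.
by move=> C /xsectionP; exact: TeU.
Qed.

(** Singletons and the subsets of a separated sequence are the only closed sets
    that the converse implication has to exhibit; both are separated. *)
Definition separated_point (A : set X) (e : R) (e0 : 0 < e) (A0 : A !=set0)
    (sepA : forall a b, A a -> A b -> a <> b -> e <= mdist a b) : H :=
  exist _ A (conj A0 (closed_separated A e e0 sepA)).

Definition singleton_point (x : X) : H.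
Proof.
apply: (separated_point [set x] 1 ltr01); first by exists x.
by move=> a b -> ->.
Defined.

(** Evaluating distance functions at [x] shows that singletons close to that of
    [x] have their point close to [x], so density passes from the hyperspace
    down to [X]. *)
Lemma second_countable_separable : @second_countable H -> separable (X := X).
Proof.
move=> [B cB [_ basB]]; have [x0 _] := X0.
pose pick (U : set H) := xget x0 [set x | U (singleton_point x)].
apply: (separable_countable (pick @` B)) => //.
  exact: card_le_trans (card_image_le _ _) cB.
move=> x e e0.
have : nbhs (singleton_point x)
    [set C : H | basic_entourage [set x] e (singleton_point x, C)].
  apply/hyperspace_nbhsP; exists ([set x], e) => //=.
  by split=> //; exact: bornology1.
move=> /basB[U [BU Ux] Ue]; exists (pick U); first by exists U.
have Upick : U (singleton_point (pick U)).
  exact: (@xgetPex _ x0 [set y | U (singleton_point y)] (ex_intro _ x Ux)).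
have := basic_entourage_lt (Ue _ Upick) (erefl : [set x] x).
by rewrite /= !dist_set1 mdistxx sub0r normrN ger0_norm ?mdist_ge0.
Qed.

(** A separated sequence in a member of [S] would embed the power set of [nat]
    in the hyperspace as a uniformly discrete set. *)
Lemma second_countable_totally_bounded : @second_countable H -> S `<=` TB.
Proof.
move=> [B cB [_ basB]] A SA; split; first by case: bS => + _ _ _; exact.
apply: contrapT => /not_totally_bounded_separated[e e0 [u Au sepu]].
(* [u 0] is added to every subset to keep it nonempty, and [I] is shifted by one
   to make room for it. *)
pose J (I : set nat) := [set n | if n is m.+1 then I m else True].
have J0 I : u @` J I !=set0 by exists (u 0%N), 0%N.
have sepJ I a b : (u @` J I) a -> (u @` J I) b -> a <> b -> e <= mdist a b.
  by move=> [m _ <-] [n _ <-] umn; apply: sepu => mn; apply: umn; rewrite mn.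
pose P I : H := separated_point (u @` J I) e e0 (J0 I) (sepJ I).
have P_sub I I' : basic_entourage A e (P I, P I') -> I `<=` I'.
  move=> PII' n In; have un : (u @` J I) (u n.+1) by exists n.+1.
  have := basic_entourage_lt PII' (Au n.+1).
  rewrite /= (dist_set_mem _ _ un) sub0r normrN => /(le_lt_trans (ler_norm _)).
  move=> /(dist_set_lt _ _ _ (J0 I'))[_ [m Jm <-] unm].
  have [mn|/eqP mn] := eqVneq n.+1 m; first by rewrite -mn in Jm.
  by have := sepu _ _ mn; rewrite leNgt unm.
have base I : exists U, [/\ B U, U (P I) &
    forall I', U (P I') -> basic_entourage A e (P I, P I')].
  have : nbhs (P I) [set C : H | basic_entourage A e (P I, C)].
    by apply/hyperspace_nbhsP; exists (A, e).
  by move=> /basB[U [BU UP] Ue]; exists U; split => // I'; exact: Ue.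
have [h hP] := choice base.
have /countable_injP[g ginj] := cB.
apply: (Cantor_set_nat (g \o h)) => I I' /= gh.
have [BI PI hI] := hP I; have [BI' PI' hI'] := hP I'.
have hh : h I = h I' by apply: ginj => //; exact: mem_set.
apply/seteqP; split; apply: P_sub.
- by apply: hI; rewrite hh.
- by apply: hI'; rewrite -hh.
Qed.

Lemma open_dist_set_itv (x : X) (p q : R) :
  open [set C : H | p < dist_set x (sval C) < q].
Proof.
rewrite openE => A /= /andP[pA Aq].
apply/hyperspace_nbhsP.
exists ([set x], Num.min (dist_set x (sval A) - p) (q - dist_set x (sval A))).
  by split; [exact: bornology1|rewrite /= lt_min !subr_gt0 pA].
move=> C /basic_entourage_lt/(_ (erefl : [set x] x)).
by rewrite /= lt_min !ltr_norml => /andP[/andP[h1 h2] /andP[h3 h4]]; lra.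
Qed.

(** A triple [(n, p, q)] of the list constrains the distance to [d n] to lie
    strictly between [p] and [q]; lists over a countable type keep the family of
    all cylinders countable. *)
Definition cylinder (d : nat -> X) (l : seq (nat * rat * rat)) : set H :=
  [set C : H | forall t, t \in l ->
    ratr t.1.2 < dist_set (d t.1.1) (sval C) < ratr t.2].

Lemma open_cylinder d l : open (cylinder d l).
Proof.
elim: l => [|t l IH].
  suff -> : cylinder d [::] = setT by exact: openT.
  by apply/seteqP; split.
have -> : cylinder d (t :: l) =
    [set C : H | ratr t.1.2 < dist_set (d t.1.1) (sval C) < ratr t.2]
    `&` cylinder d l.
  apply/seteqP; split => [C h|C [h1 h2] t' /=].
    split; first by apply: h; rewrite mem_head.
    by move=> t' t'l; apply: h; rewrite in_cons t'l orbT.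
  by rewrite in_cons => /predU1P[->//|]; exact: h2.
by apply: openI => //; exact: open_dist_set_itv.
Qed.

(** Two sets in a cylinder through [A] have distance functions within [e / 4] of
    each other on an [e / 8]-net of [T], when the cylinder bounds lie within
    [e / 8] of the values for [A]; the Lipschitz property extends this to [T]
    at the cost of [e / 8] for each of the two functions. *)
Lemma separable_second_countable : S `<=` TB -> separable (X := X) ->
  @second_countable H.
Proof.
move=> STB [d densd]; exists (range (cylinder d)).
  exact: card_le_trans (card_image_le _ _) (countableP _).
split=> [_ [l _ <-]|A U /hyperspace_nbhsP[[T e] /= [ST e0] TU]].
  exact: open_cylinder.
have e80 : 0 < e / 8 by rewrite divr_gt0.
have [_ tbT] := STB _ ST.
have [E EP] := totally_bounded_net _ _ _ densd tbT e80.
have rat_around (n : nat) : exists pq : rat * rat,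
    dist_set (d n) (sval A) - e / 8 < ratr pq.1 < dist_set (d n) (sval A) /\
    dist_set (d n) (sval A) < ratr pq.2 < dist_set (d n) (sval A) + e / 8.
  have [|p] := @rat_in_itvoo R (dist_set (d n) (sval A) - e / 8)
    (dist_set (d n) (sval A)); first lra.
  have [|q] := @rat_in_itvoo R (dist_set (d n) (sval A))
    (dist_set (d n) (sval A) + e / 8); first lra.
  by rewrite !in_itv /= => hq hp; exists (p, q).
have [r rP] := choice rat_around.
exists (cylinder d [seq (n, (r n).1, (r n).2) | n <- E]).
  split; first by eexists.
  move=> _ /mapP[n _ ->] /=.
  by have [/andP[_ ->] /andP[->]] := rP n.
move=> C CE; apply: TU; apply: basic_entourage_le => // x /EP[n nE xn].
have /= /andP[h1 h2] := CE _ (map_f _ nE).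
have [/andP[h3 h4] /andP[h5 h6]] := rP n.
have := le_lt_trans (dist_set_lip x (d n) _ (proj1 (svalP A))) xn.
have := le_lt_trans (dist_set_lip x (d n) _ (proj1 (svalP C))) xn.
rewrite !ltr_norml ler_norml => /andP[h7 h8] /andP[h9 h10].
by apply/andP; split; lra.
Qed.

End Hyperspace.

Theorem theorem6p5 (R : realType) (X : metricType R) (S : set (set X))
    (X0 : [set: X] !=set0) (bS : bornology S) :
  (totally_bounded_family S /\ S `<=` TB) <->
  @second_countable (hyperspace X0 bS).
Proof.
split=> [[tbS STB]|sc].
  apply: separable_second_countable => //.
  exact: totally_bounded_family_separable tbS.
have STB := second_countable_totally_bounded X0 bS sc.
split=> //; apply: separable_totally_bounded_family => //.
exact: second_countable_separable sc.
Qed.
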